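(* Let $A\to B$ be a homomorphism of commutative rings that is smooth, that is, finitely presented and formally smooth. Then there exist finite-type $\mathbb{Z}$-algebras $A_0$ and $B_0$, a smooth ring homomorphism $A_0\to B_0$, and a ring homomorphism $A_0\to A$, such that $A\otimes_{A_0}B_0$ is isomorphic to $B$ as an $A$-algebra. Moreover, these data can be chosen so that $A_0\to A$ is injective, in which case the induced homomorphism $B_0\to B$ (the composite of $B_0\to A\otimes_{A_0}B_0$, $b\mapsto 1\otimes b$, with the $A$-algebra isomorphism $A\otimes_{A_0}B_0\cong B$) is also injective.
   Context: All rings are commutative with $1$. A ring homomorphism $R\to S$ is called smooth if it is finitely presented (i.e. $S$ is a finitely presented $R$-algebra) and formally smooth. Formally smooth means: for every $R$-algebra $C$ and every ideal $J\subset C$ with $J^2=0$, every $R$-algebra homomorphism $S\to C/J$ lifts to an $R$-algebra homomorphism $S\to C$. A finite-type $\mathbb{Z}$-algebra is a commutative ring that is finitely generated as a $\mathbb{Z}$-algebra. *)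

(* Defs.v *)
(* Rings are [comPzRingType]s, so that the zero ring is allowed. *)
From HB Require Import structures.
From mathcomp Require Import all_boot all_algebra.
From mathcomp Require Import finmap.
From mathcomp Require Import boolp.
From mathcomp Require Import monalg.

Set Implicit Arguments.
Unset Strict Implicit.
Unset Printing Implicit Defensive.

Import GRing.Theory.

Local Open Scope fset_scope.
Local Open Scope ring_scope.
Local Open Scope quotient_scope.

(* The ideals of [ring_quotient] are proper and live in nonzero rings; here an
   ideal may contain 1. The additive quotient is the one of [ring_quotient]. *)
HB.mixin Record isIdeal (R : comPzRingType) (I : R -> bool) := {
  ideal_mull : forall a, {in I, forall x, a * x \in I}
}.

#[short(type="idealType")]
HB.structure Definition Ideal (R : comPzRingType) :=
  {I of GRing.ZmodClosed R I & isIdeal R I}.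

Definition quo (R : comPzRingType) (I : idealType R) : Type :=
  {ideal_quot I}.

Section QuotientRing.
Variables (R : comPzRingType) (I : idealType R).

HB.instance Definition _ := GRing.Zmodule.on (quo I).
HB.instance Definition _ := EqQuotient.on (quo I).

Definition quo_pi (x : R) : quo I := \pi_(quo I) x.
Definition quo_one : quo I := quo_pi 1.
Definition quo_mul (x y : quo I) : quo I := quo_pi (repr x * repr y).

Lemma quo_piK x : quo_pi (repr x) = x.
Proof. exact: reprK. Qed.

Lemma quo_piP x y : (quo_pi x = quo_pi y) <-> (x - y \in I).
Proof.
split=> [/eqP|h]; first by rewrite Quotient.idealrBE.
by apply/eqP; rewrite -Quotient.idealrBE.
Qed.

Lemma quo_piB : {morph quo_pi : x y / x - y}.
Proof. exact: (raddfB (\pi_{ideal_quot I})). Qed.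

Lemma quo_piM : {morph quo_pi : x y / x * y >-> quo_mul x y}.
Proof.
move=> x y; apply/quo_piP.
have hx : x - repr (quo_pi x) \in I by apply/quo_piP; rewrite quo_piK.
have hy : y - repr (quo_pi y) \in I by apply/quo_piP; rewrite quo_piK.
rewrite -[x * y](subrK (x * repr (quo_pi y))) -mulrBr -addrA -mulrBl.
by apply: rpredD; [|rewrite mulrC]; apply: ideal_mull.
Qed.

Lemma quo_mulA : associative quo_mul.
Proof.
move=> x y z; rewrite -(quo_piK x) -(quo_piK y) -(quo_piK z).
by rewrite -!quo_piM mulrA.
Qed.

Lemma quo_mulC : commutative quo_mul.
Proof. by move=> x y; congr quo_pi; exact: mulrC. Qed.

Lemma quo_mul1 : left_id quo_one quo_mul.
Proof. by move=> x; rewrite -(quo_piK x) -quo_piM mul1r. Qed.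

Lemma quo_piD : {morph quo_pi : x y / x + y}.
Proof. exact: (raddfD (\pi_{ideal_quot I})). Qed.

Lemma quo_mulDl : left_distributive quo_mul +%R.
Proof.
move=> x y z; rewrite -(quo_piK x) -(quo_piK y) -(quo_piK z).
by rewrite -quo_piD -!quo_piM mulrDl quo_piD.
Qed.

HB.instance Definition _ := GRing.Zmodule_isComPzRing.Build (quo I)
  quo_mulA quo_mulC quo_mul1 quo_mulDl.

HB.instance Definition _ := GRing.isZmodMorphism.Build R (quo I) quo_pi quo_piB.
HB.instance Definition _ := GRing.isMonoidMorphism.Build R (quo I) quo_pi
  (conj (erefl : quo_pi 1 = 1) quo_piM).

End QuotientRing.

Definition ideal_gen (R : comPzRingType) (X : R -> Prop) : {pred R} :=
  fun x => `[< exists (k : nat) (c y : 'I_k -> R),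
    (forall i, X (y i)) /\ x = \sum_(i < k) c i * y i >].

Section GeneratedIdeal.
Variables (R : comPzRingType) (X : R -> Prop).

Lemma ideal_genP x :
  reflect (exists (k : nat) (c y : 'I_k -> R),
             (forall i, X (y i)) /\ x = \sum_(i < k) c i * y i)
          (x \in ideal_gen X).
Proof. exact: asboolP. Qed.

Lemma ideal_gen_mull a : {in ideal_gen X, forall x, a * x \in ideal_gen X}.
Proof.
move=> x /ideal_genP [k [c [y [Xy ->]]]]; apply/ideal_genP.
exists k, (fun i => a * c i), y; split=> //.
by rewrite mulr_sumr; apply: eq_bigr => i _; rewrite mulrA.
Qed.

Lemma ideal_gen_zmod : zmod_closed (ideal_gen X).
Proof.
split.
  apply/ideal_genP; exists 0, (fun=> 0), (fun=> 0); split; first by case.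
  by rewrite big_ord0.
move=> x y hx /(ideal_gen_mull (-1)) /ideal_genP [l [d [z [Xz]]]].
rewrite mulN1r => ->; case/ideal_genP: hx => k [c [t [Xt ->]]].
apply/ideal_genP.
exists (k + l), (fun i => match split i with inl i => c i | inr j => d j end),
  (fun i => match split i with inl i => t i | inr j => z j end).
split=> [i|]; first by case: (split i).
rewrite big_split_ord; congr (_ + _); apply: eq_bigr => i _ /=.
- by rewrite (unsplitK (inl i)).
- by rewrite (unsplitK (inr i)).
Qed.

HB.instance Definition _ := GRing.isZmodClosed.Build R (ideal_gen X) ideal_gen_zmod.
HB.instance Definition _ := isIdeal.Build R (ideal_gen X) ideal_gen_mull.

End GeneratedIdeal.

(* The monoid ring R[K] of a commutative monoid (K, op, idx): finitely supported
   functions K -> R under convolution. [monalg] only multiplies such functions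
   over a nonzero ring and for a monoid without nontrivial invertible elements. *)
Definition monring (K : choiceType) (idx : K) (op : Monoid.com_law idx)
  (R : comPzRingType) : Type := {malg R[K]}.

Section MonoidRing.
Variables (K : choiceType) (idx : K) (op : Monoid.com_law idx).
Variable R : comPzRingType.
Local Notation T := (monring op R).

HB.instance Definition _ := GRing.Zmodule.on T.

Definition monr_mul (p q : T) : T :=
  \sum_(k <- msupp p) \sum_(l <- msupp q) << p@_k * q@_l *g op k l >>.

Definition monr_one : T := << 1 *g idx >>.

Lemma monr_mulw (d1 d2 : {fset K}) (p q : T) :
  msupp p `<=` d1 -> msupp q `<=` d2 ->
  monr_mul p q = \sum_(k <- d1) \sum_(l <- d2) << p@_k * q@_l *g op k l >>.
Proof.
move=> le1 le2; rewrite /monr_mul (big_fset_incl _ le1) /=.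
  apply: eq_bigr => k _; apply: big_fset_incl => // l _ /mcoeff_outdom ->.
  by rewrite mulr0 monalgU0.
move=> k _ /mcoeff_outdom pk.
by rewrite big1 // => l _; rewrite pk mul0r monalgU0.
Qed.

Lemma monr_mulC : commutative monr_mul.
Proof.
move=> p q; rewrite /monr_mul exchange_big; apply: eq_bigr => l _ /=.
by apply: eq_bigr => k _; rewrite mulrC [op _ _]Monoid.mulmC.
Qed.

Lemma monr_mulDl : left_distributive monr_mul +%R.
Proof.
move=> p q r; rewrite (monr_mulw (msuppD_le p q) (fsubset_refl _)).
rewrite (monr_mulw (fsubsetUl (msupp p) (msupp q)) (fsubset_refl (msupp r))).
rewrite (monr_mulw (fsubsetUr (msupp p) (msupp q)) (fsubset_refl (msupp r))).
rewrite -big_split; apply: eq_bigr => k _ /=.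
rewrite -big_split; apply: eq_bigr => l _ /=.
by rewrite mcoeffD mulrDl monalgUD.
Qed.

Lemma monr_mul0 : left_zero 0 monr_mul.
Proof. by move=> p; rewrite /monr_mul msupp0 big_seq_fset0. Qed.

Lemma monr_mulUU (a b : R) (k l : K) :
  monr_mul << a *g k >> << b *g l >> = << a * b *g op k l >>.
Proof.
by rewrite (monr_mulw msuppU_le msuppU_le) !big_seq_fset1 !mcoeffUU.
Qed.

Lemma monr_sumU (p : T) : p = \sum_(k <- msupp p) (<< p@_k *g k >> : T).
Proof. exact: monalgE. Qed.

Lemma monr_mul_suml I (s : seq I) (F : I -> T) q :
  monr_mul (\sum_(i <- s) F i) q = \sum_(i <- s) monr_mul (F i) q.
Proof.
exact: (big_morph (monr_mul^~ q) (fun _ _ => monr_mulDl _ _ _) (monr_mul0 _)).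
Qed.

Lemma monr_mul_sumr I (s : seq I) (F : I -> T) q :
  monr_mul q (\sum_(i <- s) F i) = \sum_(i <- s) monr_mul q (F i).
Proof.
by rewrite monr_mulC monr_mul_suml; apply: eq_bigr => i _; rewrite monr_mulC.
Qed.

Lemma monr_mulA : associative monr_mul.
Proof.
move=> p q r; rewrite (monr_sumU p) !monr_mul_suml; apply: eq_bigr => i _.
rewrite (monr_sumU q) monr_mul_suml !monr_mul_sumr monr_mul_suml.
apply: eq_bigr => j _; rewrite (monr_sumU r) !monr_mul_sumr.
by apply: eq_bigr => k _; rewrite !monr_mulUU mulrA Monoid.mulmA.
Qed.

Lemma monr_mul1 : left_id monr_one monr_mul.
Proof.
move=> p; rewrite {1}(monr_sumU p) monr_mul_sumr [RHS]monr_sumU.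
by apply: eq_bigr => k _; rewrite monr_mulUU mul1r Monoid.mul1m.
Qed.

HB.instance Definition _ := GRing.Zmodule_isComPzRing.Build T
  monr_mulA monr_mulC monr_mul1 monr_mulDl.

Definition monrU (a : R) (k : K) : T := << a *g k >>.
Definition monrC (a : R) : T := monrU a idx.

Lemma monrUM a b k l : monrU a k * monrU b l = monrU (a * b) (op k l).
Proof. exact: monr_mulUU. Qed.

Lemma monrC_zmod : zmod_morphism monrC.
Proof. by move=> a b; exact: (monalgUB idx a b). Qed.

Lemma monrC_monoid : monoid_morphism monrC.
Proof. by split=> // a b; rewrite /monrC monrUM Monoid.mul1m. Qed.

HB.instance Definition _ := GRing.isZmodMorphism.Build R T monrC monrC_zmod.
HB.instance Definition _ := GRing.isMonoidMorphism.Build R T monrC monrC_monoid.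

End MonoidRing.

(* R[X_1, ..., X_n] *)
Definition mvpoly (n : nat) (R : comPzRingType) : comPzRingType :=
  monring (@mmul 'X_{1..n} : Monoid.com_law _) R.

Definition mvpolyC (n : nat) (R : comPzRingType) : {rmorphism R -> mvpoly n R} :=
  @monrC _ _ (@mmul 'X_{1..n} : Monoid.com_law _) R.

(* An R-algebra is given by its structure morphism. *)

Definition finitely_presented (R S : comPzRingType) (f : {rmorphism R -> S}) :=
  exists (n : nat) (F : seq (mvpoly n R))
         (e : {rmorphism quo (ideal_gen (fun p => p \in F)) -> S}),
    bijective e /\ forall r, e (quo_pi _ (mvpolyC n R r)) = f r.

Definition formally_smooth (R S : comPzRingType) (f : {rmorphism R -> S}) :=
  forall (C : comPzRingType) (i : {rmorphism R -> C}) (J : idealType C),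
    (forall x y, x \in J -> y \in J -> x * y = 0) ->
  forall u : {rmorphism S -> quo J}, (forall r, u (f r) = quo_pi J (i r)) ->
  exists v : {rmorphism S -> C},
    (forall r, v (f r) = i r) /\ (forall s, quo_pi J (v s) = u s).

Definition smooth (R S : comPzRingType) (f : {rmorphism R -> S}) :=
  finitely_presented f /\ formally_smooth f.

Definition finite_type_Z (R : comPzRingType) :=
  exists (n : nat) (e : {rmorphism mvpoly n int -> R}), forall y, exists x, e x = y.

Section TensorProduct.
Variables (R A B : comPzRingType).
Variables (h : {rmorphism R -> A}) (g : {rmorphism R -> B}).

(* The free abelian group on A * B, with [a, b] * [a', b'] = [a a', b b']. *)
Definition tens_free : comPzRingType :=
  monring (@GRing.mul (A * B)%type : Monoid.com_law _) int.

Definition tens_gen (a : A) (b : B) : tens_free := monrU _ 1 (a, b).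

Inductive tens_rel : tens_free -> Prop :=
| TensDl a a' b : tens_rel (tens_gen (a + a') b - tens_gen a b - tens_gen a' b)
| TensDr a b b' : tens_rel (tens_gen a (b + b') - tens_gen a b - tens_gen a b')
| TensZ r a b : tens_rel (tens_gen (h r * a) b - tens_gen a (g r * b)).

(* The relators are stable under multiplication by the generators [a, b], so the
   ideal they generate is also the subgroup they generate. *)
Definition tensor : comPzRingType := quo (ideal_gen tens_rel).

Definition tens (a : A) (b : B) : tensor := quo_pi _ (tens_gen a b).

Lemma tensDl a a' b : tens (a + a') b = tens a b + tens a' b.
Proof.
rewrite /tens -[RHS]rmorphD; apply/quo_piP/ideal_genP.
exists 1, (fun=> 1), (fun=> tens_gen (a + a') b - tens_gen a b - tens_gen a' b).
by split=> [_|]; [exact: TensDl | rewrite big_ord1 mul1r opprD addrA].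
Qed.

Lemma tensDr a b b' : tens a (b + b') = tens a b + tens a b'.
Proof.
rewrite /tens -[RHS]rmorphD; apply/quo_piP/ideal_genP.
exists 1, (fun=> 1), (fun=> tens_gen a (b + b') - tens_gen a b - tens_gen a b').
by split=> [_|]; [exact: TensDr | rewrite big_ord1 mul1r opprD addrA].
Qed.

Lemma tensZ r a b : tens (h r * a) b = tens a (g r * b).
Proof.
apply/quo_piP/ideal_genP.
exists 1, (fun=> 1), (fun=> tens_gen (h r * a) b - tens_gen a (g r * b)).
by split=> [_|]; [exact: TensZ | rewrite big_ord1 mul1r].
Qed.

Lemma tensM a a' b b' : tens a b * tens a' b' = tens (a * a') (b * b').
Proof. by rewrite /tens -[LHS]rmorphM; congr quo_pi; exact: monrUM. Qed.

Lemma tens11 : tens 1 1 = 1.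
Proof. by []. Qed.

Definition tens_inl (a : A) : tensor := tens a 1.
Definition tens_inr (b : B) : tensor := tens 1 b.

Lemma tens_inl_zmod : zmod_morphism tens_inl.
Proof. by move=> a a'; apply: (canRL (addrK _)); rewrite -tensDl subrK. Qed.

Lemma tens_inl_monoid : monoid_morphism tens_inl.
Proof. by split=> // a a'; rewrite /tens_inl tensM mulr1. Qed.

Lemma tens_inr_zmod : zmod_morphism tens_inr.
Proof. by move=> b b'; apply: (canRL (addrK _)); rewrite -tensDr subrK. Qed.

Lemma tens_inr_monoid : monoid_morphism tens_inr.
Proof. by split=> // b b'; rewrite /tens_inr tensM mulr1. Qed.

HB.instance Definition _ :=
  GRing.isZmodMorphism.Build A tensor tens_inl tens_inl_zmod.
HB.instance Definition _ :=
  GRing.isMonoidMorphism.Build A tensor tens_inl tens_inl_monoid.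
HB.instance Definition _ :=
  GRing.isZmodMorphism.Build B tensor tens_inr tens_inr_zmod.
HB.instance Definition _ :=
  GRing.isMonoidMorphism.Build B tensor tens_inr tens_inr_monoid.

End TensorProduct.

(* A0 -> B0 is a smooth map of finite type Z-algebras, given with A0 -> A and
   an isomorphism of A-algebras from the base change to B. *)
Definition smooth_descent (A B : comPzRingType) (f : {rmorphism A -> B})
    (A0 B0 : comPzRingType) (g : {rmorphism A0 -> B0}) (h : {rmorphism A0 -> A})
    (e : {rmorphism tensor h g -> B}) :=
  [/\ finite_type_Z A0, finite_type_Z B0, smooth g, bijective e
    & forall a, e (tens_inl h g a) = f a].

(* Main.v *)
Require Import Defs.
From mathcomp Require Import all_boot all_algebra.
From HB Require Import structures.
From mathcomp Require Import finmap boolp monalg.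

(** Write a smooth algebra over R as P / I with P = R[X_1, ..., X_n] and I
generated by a finite list F. Formal smoothness, applied to the square-zero
extension P / I^2 -> P / I and the identity of P / I, gives an R-algebra section
P / I -> P / I^2. Lifting the images of the variables to P turns it into an
R-endomorphism sigma of P with sigma p = p modulo I and sigma I inside I^2
([section_mod_square]). Conversely such a sigma gives formal smoothness of P / I:
any lift P -> C of a map P / I -> C / J kills I^2, so its composite with sigma
kills I. Both halves of the theorem use sigma instead of formal smoothness.

Existence. The conditions on sigma are finitely many polynomial identities: each
sigma X_i - X_i is a combination of F, and each sigma f, for f in F, is a
combination of products of two elements of F. Let A0 be the subring of A generated
by all the coefficients that occur; it is of finite type over Z, and F, sigma and the
identities already live over A0. Hence the ideal generated by F in A0[X_1, ..., X_n]
defines a smooth A0-algebra, whose base change to A has the presentation of B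
([smooth_descent_exists], [presentation_base_change]).

Injectivity. This is an instance of the flatness of B0 over A0, and is proved by
Krull's intersection theorem. Let p represent an element of B0 = P / I that dies in
the tensor product. Then p = sum_j a_j r_j in A[X_1, ..., X_n] with a_j in A and
r_j in I. Applying the n-th iterate of sigma, which fixes the a_j, gives
sigma^n p = sum_j a_j sigma^n (r_j), with sigma^n (r_j) in the 2^n-th power of I.
Since sigma^n p = p modulo I, the element p lies in I + I^(2^n) U for every n, where
U is the P-module spanned by 1 and the a_j. As P is Noetherian (Hilbert), U / I is
a Noetherian module in which the class of p is killed by I and is divisible by all
powers of I, so that this class is zero ([krull_intersection],
[ideal_contraction], [smooth_tens_inr_injective]). *)

Set Implicit Arguments.
Unset Strict Implicit.
Unset Printing Implicit Defensive.

Import GRing.Theory.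

Local Open Scope ring_scope.

(** * Universal properties of monoid rings, quotients and tensor products *)

Section MonoidRingLift.
Variables (K : choiceType) (idx : K) (op : Monoid.com_law idx).
Variables (R S : comPzRingType) (phi : {rmorphism R -> S}) (m : K -> S).
Hypothesis m1 : m idx = 1.
Hypothesis mM : forall k l, m (op k l) = m k * m l.

(** A monoid ring is the free commutative algebra on its monoid. Polynomial rings and
the ring underlying the tensor product are both monoid rings, and their universal
properties come from this one. *)
Lemma monring_lift :
  exists e : {rmorphism monring op R -> S},
    forall a k, e (monrU op a k) = phi a * m k.
Proof.
pose ev (p : monring op R) : S := \sum_(k <- msupp p) phi p@_k * m k.
have evw (d : {fset K}) p : (msupp p `<=` d)%fset ->
    ev p = \sum_(k <- d) phi p@_k * m k.
  move=> le; rewrite /ev; apply: big_fset_incl => // k _ /mcoeff_outdom ->.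
  by rewrite rmorph0 mul0r.
have evU a k : ev (monrU op a k) = phi a * m k.
  by rewrite (evw _ _ msuppU_le) big_seq_fset1 mcoeffUU.
have evB : zmod_morphism ev.
  move=> p q; rewrite (evw _ _ (msuppB_le p q)).
  rewrite (evw _ _ (fsubsetUl (msupp p) (msupp q))).
  rewrite (evw _ _ (fsubsetUr (msupp p) (msupp q))) -sumrB.
  by apply: eq_bigr => k _; rewrite mcoeffB rmorphB mulrBl.
pose eA : {additive monring op R -> S} :=
  HB.pack ev (GRing.isZmodMorphism.Build _ _ _ evB).
have evS I (r : seq I) F : ev (\sum_(i <- r) F i) = \sum_(i <- r) ev (F i).
  exact: (raddf_sum eA).
have evM : monoid_morphism ev.
  split=> [|p q]; first by rewrite evU rmorph1 mul1r.
  rewrite (monr_sumU p) (monr_sumU q) mulr_suml !evS mulr_suml.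
  apply: eq_bigr => k _ /=; rewrite mulr_sumr evS mulr_sumr.
  apply: eq_bigr => l _ /=.
  rewrite (monrUM op p@_k q@_l k l :
    (<< p@_k *g k >> : monring op R) * << q@_l *g l >> = _).
  rewrite -[in RHS]/(monrU op _ _) -[in RHS]/(monrU op _ _).
  by rewrite !evU rmorphM mM mulrACA.
pose e : {rmorphism monring op R -> S} := HB.pack ev
  (GRing.isZmodMorphism.Build _ _ _ evB) (GRing.isMonoidMorphism.Build _ _ _ evM).
by exists e => a k; apply: evU.
Qed.

End MonoidRingLift.

Lemma monring_ext (K : choiceType) (idx : K) (op : Monoid.com_law idx)
    (R : comPzRingType) (S : zmodType) (e e' : {additive monring op R -> S}) :
  (forall a k, e (monrU op a k) = e' (monrU op a k)) -> e =1 e'.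
Proof.
move=> ee p; rewrite (monr_sumU p) !raddf_sum.
by apply: eq_bigr => k _; apply: ee.
Qed.

Definition mvX (n : nat) (R : comPzRingType) (i : 'I_n) : mvpoly n R :=
  monrU _ 1 (ucm i).

Section Polynomials.
Variables (n : nat) (R : comPzRingType).

Lemma mvpoly_lift (S : comPzRingType) (phi : {rmorphism R -> S})
    (v : 'I_n -> S) :
  exists e : {rmorphism mvpoly n R -> S},
    (forall r, e (mvpolyC n R r) = phi r) /\ (forall i, e (mvX R i) = v i).
Proof.
pose m (k : 'X_{1..n}) : S := \prod_(i < n) v i ^+ k i.
have m1 : m mone = 1 by apply: big1 => i _; rewrite cm1 expr0.
have mM k l : m (mmul k l) = m k * m l.
  by rewrite -big_split; apply: eq_bigr => i _; rewrite cmM exprD.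
have [e eU] := @monring_lift _ _ (@mmul 'X_{1..n} : Monoid.com_law _)
  R S phi m m1 mM.
exists e; split=> [r|i]; rewrite eU; first by rewrite m1 mulr1.
rewrite rmorph1 mul1r /m (bigD1 i) //= cmUU expr1 big1 ?mulr1 // => j ji.
by rewrite cmU eq_sym (negbTE ji) expr0.
Qed.

(** Every monomial other than 1 is a variable times a monomial of smaller degree, so
the constants and the variables generate the polynomial ring. *)
Lemma mvpoly_ind (Q : mvpoly n R -> Prop) :
  (forall r, Q (mvpolyC n R r)) -> (forall i, Q (mvX R i)) ->
  (forall p q, Q p -> Q q -> Q (p + q)) ->
  (forall p q, Q p -> Q q -> Q (p * q)) -> forall p, Q p.
Proof.
move=> QC QX QD QM p; rewrite (monr_sumU p).
apply: big_ind => //; first by rewrite -(rmorph0 (mvpolyC n R)).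
have Q1 : Q 1 by rewrite -(rmorph1 (mvpolyC n R)).
have QU : forall d (k : 'X_{1..n}), mdeg k = d -> Q (monrU _ 1 k).
  elim=> [|d IH] k kd; first by rewrite (mdeg_eq0I kd).
  have [i ki] : exists i, k i != 0%N.
    apply: contra_eqP kd => /forallNP k0.
    rewrite (_ : k = mone) ?mdeg1 //; apply/eqP/cmP => i.
    by rewrite cm1; apply/eqP/negPn/negP/k0.
  have kE : k = mmul (ucm i) (divcm k (ucm i)).
    apply/eqP/cmP => j; rewrite cmM divcmE cmU.
    by case: eqVneq => [<-|_]; rewrite ?subn0 // subnKC // lt0n.
  rewrite kE -[1]mulr1 -(monrUM (@mmul 'X_{1..n} : Monoid.com_law _)).
  apply: QM; first exact: QX.
  by apply: IH; move: kd; rewrite {1}kE mdegM mdegU => -[].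
move=> k _; have -> : << p@_k *g k >> = mvpolyC n R p@_k * monrU _ 1 k.
  by rewrite [RHS]monrUM mulr1 Monoid.mul1m.
by apply: QM; [exact: QC | exact: (QU _ k erefl)].
Qed.

Lemma mvpoly_ext (S : comPzRingType) (e e' : {rmorphism mvpoly n R -> S}) :
  (forall r, e (mvpolyC n R r) = e' (mvpolyC n R r)) ->
  (forall i, e (mvX R i) = e' (mvX R i)) -> e =1 e'.
Proof.
move=> eC eX; apply: mvpoly_ind => // p q ep eq.
  by rewrite !rmorphD ep eq.
by rewrite !rmorphM ep eq.
Qed.

End Polynomials.

(** The coefficient formula is what transfers injectivity from h to its extension to
polynomials. *)
Lemma mvpoly_map (n : nat) (R S : comPzRingType) (h : {rmorphism R -> S}) :
  exists e : {rmorphism mvpoly n R -> mvpoly n S},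
    [/\ forall r, e (mvpolyC n R r) = mvpolyC n S (h r),
        forall i, e (mvX R i) = mvX S i,
        forall a k, e (monrU _ a k) = monrU _ (h a) k
      & forall p k, (e p)@_k = h p@_k].
Proof.
pose op := @mmul 'X_{1..n} : Monoid.com_law _.
have UM k l : monrU op (1 : S) (op k l) = monrU op 1 k * monrU op 1 l.
  by rewrite monrUM mulr1.
have [e eU] := @monring_lift _ _ op R (mvpoly n S) (mvpolyC n S \o h)
  (fun k => monrU op 1 k) erefl UM.
have eU' a k : e (monrU _ a k) = monrU _ (h a) k.
  by rewrite eU /= [LHS]monrUM mulr1 Monoid.mul1m.
exists e; split=> [r|i|//|p k]; first exact: eU'.
  by rewrite eU' rmorph1.
pose u : mvpoly n R -> S := fun x => (e x)@_k.
pose v : mvpoly n R -> S := fun x => h x@_k.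
have uB : zmod_morphism u by move=> x y; rewrite /u rmorphB; apply: mcoeffB.
have vB : zmod_morphism v.
  by move=> x y; rewrite /v -rmorphB; congr (h _); apply: mcoeffB.
pose ua : {additive mvpoly n R -> S} :=
  HB.pack u (GRing.isZmodMorphism.Build _ _ _ uB).
pose va : {additive mvpoly n R -> S} :=
  HB.pack v (GRing.isZmodMorphism.Build _ _ _ vB).
apply: (@monring_ext _ _ _ _ _ ua va) => a l; rewrite /= /u /v eU'.
by rewrite !mcoeffU raddfMn.
Qed.

Lemma ideal_gen_ind (R : comPzRingType) (X : R -> Prop) (Q : R -> Prop) :
  Q 0 -> (forall x y, Q x -> Q y -> Q (x + y)) ->
  (forall a x, X x -> Q (a * x)) -> forall x, x \in ideal_gen X -> Q x.
Proof.
move=> Q0 QD QX x /ideal_genP [k [c [y [Xy ->]]]].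
by apply: big_ind => // i _; apply: QX.
Qed.

Lemma mem_ideal_gen (R : comPzRingType) (X : R -> Prop) x :
  X x -> x \in ideal_gen X.
Proof.
move=> Xx; apply/ideal_genP; exists 1, (fun=> 1), (fun=> x).
by split=> //; rewrite big_ord1 mul1r.
Qed.

Lemma rmorph_ideal_gen (R S : comPzRingType) (f : {rmorphism R -> S})
    (X : R -> Prop) (J : idealType S) :
  (forall x, X x -> f x \in J) -> forall x, x \in ideal_gen X -> f x \in J.
Proof.
move=> XJ; apply: ideal_gen_ind => [|x y fx fy|a x Xx].
- by rewrite rmorph0 rpred0.
- by rewrite rmorphD rpredD.
- by rewrite rmorphM ideal_mull //; apply: XJ.
Qed.

Lemma rmorph_ideal_gen0 (R S : comPzRingType) (f : {rmorphism R -> S})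
    (X : R -> Prop) :
  (forall x, X x -> f x = 0) -> forall x, x \in ideal_gen X -> f x = 0.
Proof.
move=> X0; apply: ideal_gen_ind => [|x y fx fy|a x Xx].
- by rewrite rmorph0.
- by rewrite rmorphD fx fy addr0.
- by rewrite rmorphM (X0 x) // mulr0.
Qed.

Section Quotients.
Variables (R : comPzRingType) (I : idealType R).

Lemma quo_pi_eq0 x : (quo_pi I x = 0) <-> (x \in I).
Proof. by rewrite -(rmorph0 (quo_pi I)) quo_piP subr0. Qed.

Lemma quo_lift (S : comPzRingType) (phi : {rmorphism R -> S}) :
  (forall x, x \in I -> phi x = 0) ->
  exists e : {rmorphism quo I -> S}, forall x, e (quo_pi I x) = phi x.
Proof.
move=> phi0; pose ev (q : quo I) : S := phi (repr q).
have evE x : ev (quo_pi I x) = phi x.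
  apply/eqP; rewrite -subr_eq0 -rmorphB; apply/eqP/phi0/quo_piP.
  exact: quo_piK.
have evB : zmod_morphism ev.
  by move=> p q; rewrite -(quo_piK p) -(quo_piK q) -rmorphB !evE rmorphB.
have evM : monoid_morphism ev.
  split=> [|p q]; first by rewrite -[X in ev X](rmorph1 (quo_pi I)) evE rmorph1.
  by rewrite -(quo_piK p) -(quo_piK q) -rmorphM !evE rmorphM.
pose e : {rmorphism quo I -> S} := HB.pack ev
  (GRing.isZmodMorphism.Build _ _ _ evB) (GRing.isMonoidMorphism.Build _ _ _ evM).
by exists e.
Qed.

End Quotients.

Section Tensor.
Variables (R A B S : comPzRingType).
Variables (h : {rmorphism R -> A}) (g : {rmorphism R -> B}).

Lemma tensor_lift (u : {rmorphism A -> S}) (w : {rmorphism B -> S}) :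
  (forall r, u (h r) = w (g r)) ->
  exists e : {rmorphism tensor h g -> S}, forall a b, e (tens h g a b) = u a * w b.
Proof.
move=> uw; pose m (k : A * B) : S := u k.1 * w k.2.
have m1 : m 1 = 1 by rewrite /m !rmorph1 mulr1.
have mM k l : m (k * l) = m k * m l by rewrite /m !rmorphM mulrACA.
have [e0 e0U] :=
  @monring_lift _ _ (@GRing.mul (A * B)%type : Monoid.com_law _) int S intr
    m m1 mM.
have e0g a b : e0 (tens_gen a b) = u a * w b by rewrite e0U rmorph1 mul1r.
have [|e eE] := @quo_lift _ (ideal_gen (tens_rel h g)) _ e0.
  apply: rmorph_ideal_gen0 => x [a a' b|a b b'|r a b]; rewrite !rmorphB !e0g.
  - by rewrite rmorphD mulrDl addrAC addrK subrr.
  - by rewrite rmorphD mulrDr addrAC addrK subrr.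
  - by rewrite !rmorphM uw mulrCA mulrA subrr.
by exists e => a b; rewrite eE.
Qed.

(** In the monoid ring over Z an integral multiple n [a, b] is n times the product of
[a, 1] and [1, b], so the two factors generate the tensor product as a ring. *)
Lemma tensor_ext (e e' : {rmorphism tensor h g -> S}) :
  (forall a, e (tens_inl h g a) = e' (tens_inl h g a)) ->
  (forall b, e (tens_inr h g b) = e' (tens_inr h g b)) -> e =1 e'.
Proof.
move=> ea eb q; rewrite -(quo_piK q); move: (repr q) => p.
apply: (@monring_ext _ _ _ _ _ (e \o quo_pi _) (e' \o quo_pi _)) => n [a b].
have E : quo_pi _ (monrU _ n (a, b)) =
    n%:~R * (tens_inl h g a * tens_inr h g b) :> tensor h g.
  rewrite tensM mulr1 mul1r -[n%:~R](rmorph_int (quo_pi (ideal_gen (tens_rel h g)))).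
  rewrite /tens -rmorphM; congr quo_pi.
  rewrite -[n in LHS]mulr1 -[(a, b)]mul1r -(monrUM _ n 1 1 (a, b)).
  congr (_ * _); rewrite -[n in LHS]intz.
  exact: (rmorph_int (@monrC _ _ (@GRing.mul (A * B)%type : Monoid.com_law _) int)).
by rewrite /= E !rmorphM !rmorph_int ea eb.
Qed.

End Tensor.

(** * Noetherian modules *)

Lemma seq_bound (T : eqType) (P : T -> nat -> Prop) (s : seq T) :
  (forall x m n, (m <= n)%N -> P x m -> P x n) ->
  (forall x, x \in s -> exists m, P x m) ->
  exists m, forall x, x \in s -> P x m.
Proof.
move=> Pmono; elim: s => [|y s IH] Ps; first by exists 0.
have [m Pm] := IH (fun x xs => Ps x (mem_behead (s := y :: s) xs)).
have [k Pk] := Ps y (mem_head y s).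
exists (maxn m k) => x; rewrite inE => /orP[/eqP->|/Pm].
  exact: Pmono (leq_maxr _ _) Pk.
exact: Pmono (leq_maxl _ _).
Qed.

Section Submodules.
Variables (R : pzRingType) (M : lmodType R).
Implicit Types (U V W T X : M -> Prop) (s : seq M).

Definition submodule U :=
  U 0 /\ forall a x y, U x -> U y -> U (a *: x + y).

(** Defined as an intersection: a property of all elements of the submodule
follows at once when it defines a submodule that contains the generators. *)
Definition generated X (x : M) :=
  forall U, submodule U -> (forall y, X y -> U y) -> U x.

Definition spanned s := generated (fun y => y \in s).

Definition noetherian U :=
  forall V, submodule V -> (forall x, V x -> U x) ->
  exists s, forall x, V x <-> spanned s x.

Lemma submoduleZ U a x : submodule U -> U x -> U (a *: x).
Proof. by case=> U0 UD Ux; rewrite -[_ *: _]addr0; apply: UD. Qed.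

Lemma submoduleD U x y : submodule U -> U x -> U y -> U (x + y).
Proof. by case=> _ UD Ux Uy; rewrite -[x]scale1r; apply: UD. Qed.

Lemma submoduleB U x y : submodule U -> U x -> U y -> U (x - y).
Proof.
by move=> Us Ux Uy; rewrite -scaleN1r; apply: submoduleD => //; apply: submoduleZ.
Qed.

Lemma generated_submodule X : submodule (generated X).
Proof.
split=> [U [U0 _] //|a x y Xx Xy U Us XU].
by apply: (proj2 Us); [apply: Xx | apply: Xy].
Qed.

Lemma mem_generated X x : X x -> generated X x.
Proof. by move=> Xx U _; apply. Qed.

Lemma submoduleI U V : submodule U -> submodule V -> submodule (fun x => U x /\ V x).
Proof.
move=> [U0 UD] [V0 VD]; split=> // a x y [Ux Vx] [Uy Vy].
by split; [apply: UD | apply: VD].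
Qed.

Lemma spanned_cons v s x :
  spanned (v :: s) x -> exists r u, spanned s u /\ x = r *: v + u.
Proof.
have Ss := generated_submodule (fun y => y \in s).
move/(_ (fun x => exists r u, spanned s u /\ x = r *: v + u)); apply; first split.
- by exists 0, 0; split; [apply: (proj1 Ss) | rewrite scale0r addr0].
- move=> a _ _ [r [u [su ->]]] [q [w [sw ->]]].
  exists (a * r + q), (a *: u + w); split; first exact: (proj2 Ss).
  by rewrite scalerDl scalerDr scalerA addrACA.
- move=> y; rewrite inE => /orP[/eqP->|ys].
    by exists 1, 0; split; [apply: (proj1 Ss) | rewrite scale1r addr0].
  by exists 0, y; split; [apply: mem_generated | rewrite scale0r add0r].
Qed.

Lemma noetherian_acc U (T : nat -> M -> Prop) :
  noetherian U -> (forall n, submodule (T n)) ->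
  (forall n x, T n x -> U x) -> (forall n x, T n x -> T n.+1 x) ->
  exists n, forall m x, T m x -> T n x.
Proof.
move=> Un Ts TU Tmono.
have Tle m n x : (m <= n)%N -> T m x -> T n x.
  by move=> /subnK <-; elim: (n - m)%N => // k IH /IH; rewrite addSn; apply: Tmono.
have [||s sE] := Un (fun x => exists n, T n x).
- split=> [|a x y [m Tx] [n Ty]]; first by exists 0%N; apply: (proj1 (Ts 0%N)).
  exists (maxn m n); apply: (proj2 (Ts _)).
    exact: Tle (leq_maxl _ _) Tx.
  exact: Tle (leq_maxr _ _) Ty.
- by move=> x [n]; apply: TU.
have [x m n mn|x xs|n sT] := @seq_bound _ (fun x n => T n x) s.
- exact: Tle.
- by apply/sE; apply: mem_generated.
- exists n => m x Tx; suff: spanned s x by apply.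
  by apply/sE; exists m.
Qed.

(** Otherwise dependent choice builds a strictly increasing sequence of submodules. *)
Lemma noetherian_max U (Q : (M -> Prop) -> Prop) T0 :
  noetherian U ->
  (forall T, Q T -> submodule T /\ forall x, T x -> U x) -> Q T0 ->
  exists2 T, Q T & forall T', Q T' -> (forall x, T x -> T' x) ->
                   forall x, T' x -> T x.
Proof.
move=> Un QU Q0; apply: contrapT => nomax.
have step (T : {T | Q T}) : exists T' : {T | Q T},
    (forall x, sval T x -> sval T' x) /\ exists x, sval T' x /\ ~ sval T x.
  case: T => T QT /=; apply: contrapT => noT; apply: nomax.
  exists T => // T' QT' TT' x T'x.
  apply: contrapT => nTx; apply: noT; exists (exist _ T' QT'); split=> //.
  by exists x.
have [next nextP] := choice step.
pose c := fix c n := if n is n'.+1 then next (c n') else exist _ T0 Q0.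
have [|n x|n x|n nmax] := @noetherian_acc U (fun n => sval (c n)) Un.
- by move=> n; case: (QU _ (svalP (c n))).
- by case: (QU _ (svalP (c n))) => _; apply.
- by move=> cx; apply: (proj1 (nextP (c n))).
have [x [cx ncx]] := proj2 (nextP (c n)).
by apply: ncx; apply: (nmax n.+1).
Qed.

End Submodules.

Definition noetherian_ring (R : pzRingType) :=
  @noetherian R R^o (fun=> True).

(** Induction on the number of generators. A submodule V of Rv + <s> is generated by
generators of its intersection with <s> together with lifts to V of generators of the
ideal of the coefficients of v in elements of V. *)
Lemma noetherian_span (R : pzRingType) (M : lmodType R) (s : seq M) :
  noetherian_ring R -> noetherian (spanned s).
Proof.
move=> Rn; elim: s => [|v s IH] V Vs VS.
  exists [::] => x; split=> [/VS //|]; apply=> //.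
have Ss := generated_submodule (fun y => y \in s).
pose L (r : R) := exists u, spanned s u /\ V (r *: v + u).
have Ls : @submodule R R^o L.
  split.
    by exists 0; rewrite scale0r addr0; split; [apply: (proj1 Ss)|apply: (proj1 Vs)].
  move=> a r q [u [su Vu]] [w [sw Vw]]; exists (a *: u + w); split; first exact: (proj2 Ss).
  rewrite scalerDl addrACA -scalerA -scalerDr; exact: (proj2 Vs).
have [rs rsE] := Rn L Ls (fun _ _ => I).
have [t tE] := IH (fun x => V x /\ spanned s x) (submoduleI Vs Ss) (fun x h => proj2 h).
have /choice [w wP] (r : R) : exists w, r \in rs -> V w /\ spanned s (w - r *: v).
  case: (boolP (r \in rs)) => [rrs|_]; last by exists 0.
  have /rsE [u [su Vu]] : spanned rs r by apply: mem_generated.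
  by exists (r *: v + u) => _; rewrite addrAC subrr add0r.
pose g := [seq w r | r <- rs] ++ t.
have Gs := generated_submodule (fun y => y \in g).
have gV x : spanned g x -> V x.
  apply=> // y; rewrite mem_cat => /orP[/mapP[r rrs ->]|yt].
    by case: (wP r rrs).
  by have /tE[] : spanned t y by apply: mem_generated.
have Lg r : L r -> exists y, spanned g y /\ spanned s (y - r *: v).
  move=> /rsE /(_ (fun r : R => exists y, spanned g y /\ spanned s (y - r *: v))).
  apply; first split.
  - by exists 0; rewrite scale0r subr0; split; [apply: (proj1 Gs)|apply: (proj1 Ss)].
  - move=> a r1 r2 [y1 [g1 s1]] [y2 [g2 s2]]; exists (a *: y1 + y2); split.
      exact: (proj2 Gs).
    rewrite scalerDl opprD addrACA -scalerA -scalerBr; exact: (proj2 Ss).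
  - move=> r' rrs; exists (w r'); split; last by case: (wP r' rrs).
    by apply: mem_generated; rewrite mem_cat map_f.
exists g => x; split=> [Vx|/gV //].
have [r [u [su xE]]] := spanned_cons (VS x Vx).
have [|y [gy sy]] := Lg r; first by exists u; rewrite -xE.
rewrite -[x](subrK y) addrC; apply: (submoduleD Gs) => //.
have /tE : V (x - y) /\ spanned s (x - y).
  split; first by apply: (submoduleB Vs) => //; apply: gV.
  rewrite xE (_ : _ - _ = u - (y - r *: v)); first exact: (submoduleB Ss).
  by rewrite opprB addrA [u + _]addrC.
apply=> // z zt; apply: mem_generated; by rewrite mem_cat zt orbT.
Qed.

(** * Hilbert's basis theorem *)

(** The target of phi, as a module over its source. An alias keeps this
structure apart from the module structure of S over itself. *)
Definition restrict_scalars (R S : comPzRingType) (phi : {rmorphism R -> S}) : Type := S.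

Section Restriction.
Variables (R S : comPzRingType) (phi : {rmorphism R -> S}).

HB.instance Definition _ := GRing.Zmodule.on (restrict_scalars phi).

Definition restrict_scale (a : R) (x : restrict_scalars phi) : restrict_scalars phi :=
  phi a * (x : S).

Lemma restrict_scaleA a b x :
  restrict_scale a (restrict_scale b x) = restrict_scale (a * b) x.
Proof. by rewrite /restrict_scale rmorphM mulrA. Qed.

Lemma restrict_scale1 : left_id 1 restrict_scale.
Proof. by move=> x; rewrite /restrict_scale rmorph1 mul1r. Qed.

Lemma restrict_scaleDr : right_distributive restrict_scale +%R.
Proof. by move=> a x y; apply: mulrDr. Qed.

Lemma restrict_scaleDl x : {morph restrict_scale^~ x : a b / a + b}.
Proof. by move=> a b; rewrite /restrict_scale rmorphD; apply: mulrDl. Qed.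

HB.instance Definition _ := GRing.Zmodule_isLmodule.Build R (restrict_scalars phi)
  restrict_scaleA restrict_scale1 restrict_scaleDr restrict_scaleDl.

Lemma restrict_scalarsE (a : R) (x : restrict_scalars phi) : a *: x = phi a * (x : S) :> S.
Proof. by []. Qed.

End Restriction.

Section Hilbert.
Variables (R S : comPzRingType) (phi : {rmorphism R -> S}) (t : S).
Hypothesis t_gen : forall Q : S -> Prop,
  (forall r, Q (phi r)) -> Q t -> (forall x y, Q x -> Q y -> Q (x + y)) ->
  (forall x y, Q x -> Q y -> Q (x * y)) -> forall x, Q x.

(** The R-combinations of the powers of t of exponent less than d. They replace
the polynomials of degree less than d, since S is only a quotient of R[t]. *)
Let low d : S -> Prop := @spanned R (restrict_scalars phi) [seq t ^+ i | i <- iota 0 d].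

Let low_submod d : @submodule R (restrict_scalars phi) (low d).
Proof. exact: generated_submodule. Qed.

Let lowD d x y : low d x -> low d y -> low d (x + y).
Proof. exact: (submoduleD (low_submod d)). Qed.

Let lowB d x y : low d x -> low d y -> low d (x - y).
Proof. exact: (submoduleB (low_submod d)). Qed.

Let lowZ d r x : low d x -> low d (phi r * x).
Proof. exact: (@submoduleZ R (restrict_scalars phi) (low d) r x (low_submod d)). Qed.

Let low_exp d i : (i < d)%N -> low d (t ^+ i).
Proof.
by move=> id; apply: mem_generated; apply/mapP; exists i; rewrite ?mem_iota.
Qed.

Let low_ind d (Q : S -> Prop) : @submodule R (restrict_scalars phi) Q ->
  (forall i, (i < d)%N -> Q (t ^+ i)) -> forall x, low d x -> Q x.
Proof.
move=> Qs Qt x; apply=> // y /mapP[i]; rewrite mem_iota => /andP[_ id] ->.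
exact: Qt.
Qed.

Let low_le d e x : (d <= e)%N -> low d x -> low e x.
Proof.
move=> de; apply: low_ind => // i id.
by apply: low_exp; apply: leq_trans id de.
Qed.

Let low_expM d i x : low d x -> low (i + d) (t ^+ i * x).
Proof.
move: x; apply: low_ind => [|j jd]; last first.
  by rewrite -exprD; apply: low_exp; rewrite ltn_add2l.
split=> [|a x y lx ly]; first by rewrite mulr0; apply: (proj1 (low_submod _)).
by rewrite mulrDr mulrCA; apply: (proj2 (low_submod _)).
Qed.

Let lowM d e x y : low d x -> low e y -> low (d + e) (x * y).
Proof.
move=> lx ly; move: x lx; apply: low_ind => [|j jd].
  split=> [|a x z lx lz]; first by rewrite mul0r; apply: (proj1 (low_submod _)).
  by rewrite mulrDl -mulrA; apply: (proj2 (low_submod _)).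
by apply: (low_le _ (@low_expM _ j _ ly)); rewrite leq_add2r ltnW.
Qed.

Let low_all x : exists d, low d x.
Proof.
apply: (t_gen (Q := fun x => exists d, low d x)).
- by move=> r; exists 1%N; rewrite -[phi r]mulr1; apply: lowZ; rewrite -(expr0 t); apply: low_exp.
- by exists 2%N; rewrite -[t]expr1; apply: low_exp.
- move=> {}x y [d lx] [e ly]; exists (maxn d e).
  apply: lowD; first by apply: (low_le _ lx); rewrite leq_maxl.
  by apply: (low_le _ ly); rewrite leq_maxr.
- by move=> {}x y [d lx] [e ly]; exists (d + e)%N; apply: lowM.
Qed.

Let low_lead d x : low d.+1 x -> exists r, low d (x - phi r * t ^+ d).
Proof.
move: x; apply: low_ind => [|i].
  split=> [|a x y [r xr] [q yq]].
    by exists 0; rewrite rmorph0 mul0r subr0; apply: (proj1 (low_submod _)).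
  exists (a * r + q); rewrite rmorphD rmorphM mulrDl opprD addrACA -mulrA -mulrBr.
  exact: (proj2 (low_submod _)).
rewrite ltnS leq_eqVlt => /orP[/eqP->|id].
  by exists 1; rewrite rmorph1 mul1r subrr; apply: (proj1 (low_submod _)).
by exists 0; rewrite rmorph0 mul0r subr0; apply: low_exp.
Qed.

(** The usual argument with leading coefficients, carried out in S. The leading
coefficients of elements of an ideal V form an ideal of R, with finitely many
generators; these occur in one common degree D, as multiplication by t raises the
degree. Elements of V realising them reduce any element of V to one of degree less
than D, and those form a submodule of the finitely generated R-module [low D]. *)
Theorem hilbert_basis : noetherian_ring R -> noetherian_ring S.
Proof.
move=> Rn V Vs _.
have VM a x : V x -> V (a * x) by apply: (@submoduleZ S S^o V a x Vs).
have VB x y : V x -> V y -> V (x - y) by apply: (submoduleB Vs).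
pose lead r d := exists2 s, V s & low d (s - phi r * t ^+ d).
have lead_le r d e : (d <= e)%N -> lead r d -> lead r e.
  move=> /subnK <- [s Vs' ls]; exists (t ^+ (e - d) * s); first exact: VM.
  rewrite exprD [phi r * _]mulrCA -mulrBr; exact: low_expM.
have [||rs rsE] := Rn (fun r => exists d, lead r d) => //.
  split=> [|a r q [d lr] [e lq]].
    exists 0%N, 0; first exact: (proj1 Vs).
    by rewrite rmorph0 mul0r subrr; apply: (proj1 (low_submod _)).
  exists (maxn d e).
  have [s Vs1 ls1] := lead_le _ _ _ (leq_maxl d e) lr.
  have [u Vu lu] := lead_le _ _ _ (leq_maxr d e) lq.
  exists (phi a * s + u); first exact: (proj2 Vs).
  rewrite rmorphD rmorphM mulrDl opprD addrACA -mulrA -mulrBr.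
  exact: (proj2 (low_submod _)).
have [D leadD] : exists D, forall r, r \in rs -> lead r D.
  apply: (@seq_bound _ lead rs) => [r m n|r rrs]; first exact: lead_le.
  by apply/rsE; apply: mem_generated.
have /choice [w wP] (r : R) :
    exists s, r \in rs -> V s /\ low D (s - phi r * t ^+ D).
  case: (boolP (r \in rs)) => [/leadD[s]|_]; last by exists 0.
  by exists s.
have [|//|us usE] := @noetherian_span _ (restrict_scalars phi) [seq t ^+ i | i <- iota 0 D] Rn
  (fun x => V x /\ low D x).
  apply: submoduleI (low_submod _); split=> [|a x y Vx Vy]; first exact: (proj1 Vs).
  by apply: (submoduleD Vs) => //; apply: VM.
- by move=> x [].
pose g : seq S^o := [seq w r | r <- rs] ++ us.
have Gs : submodule (spanned g) by apply: generated_submodule.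
have gV x : spanned g x -> V x.
  apply=> // y; rewrite mem_cat => /orP[/mapP[r rrs ->]|yu].
    by case: (wP r rrs).
  by have /usE[] : spanned us y by apply: mem_generated.
have lead_g r d : lead r d -> exists2 y, spanned g y & low D (y - phi r * t ^+ D).
  move=> lr; have : spanned rs r by apply/rsE; exists d.
  move/(_ (fun r : R => exists2 y, spanned g y & low D (y - phi r * t ^+ D))); apply.
    split=> [|a r1 r2 [y1 g1 l1] [y2 g2 l2]].
      exists 0; first exact: (proj1 Gs).
      by rewrite rmorph0 mul0r subrr; apply: (proj1 (low_submod _)).
    exists (phi a * y1 + y2); first exact: (proj2 Gs).
    rewrite rmorphD rmorphM mulrDl opprD addrACA -mulrA -mulrBr.
    exact: (proj2 (low_submod _)).
  move=> q qrs; have [Vw lw] := wP q qrs; exists (w q) => //.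
  by apply: mem_generated; rewrite mem_cat map_f.
have base x : V x -> low D x -> spanned g x.
  move=> Vx lx; have : spanned us x by apply/usE.
  apply; last by move=> y yu; apply: mem_generated; rewrite mem_cat yu orbT.
  split=> [|a y z gy gz]; first exact: (proj1 Gs).
  exact: (proj2 Gs).
exists g => x; split=> [Vx|/gV //].
have [d] := low_all x; elim: d x Vx => [|d IH] x Vx lx.
  by apply: base => //; apply: (low_le _ lx).
case: (leqP d.+1 D) => [dD|Dd]; first by apply: base => //; apply: (low_le _ lx).
have [r lr] := low_lead lx.
have [|y gy ly] := @lead_g r d; first by exists x.
(* The multiple t^(d - D) y has the same leading coefficient as x in degree d. *)
have gty : spanned g (t ^+ (d - D) * y) by apply: (@submoduleZ S S^o _ _ y Gs).
rewrite -[x](subrK (t ^+ (d - D) * y)); apply: (submoduleD Gs) => //.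
apply: IH; first by apply: VB => //; apply: gV.
have := @low_expM _ (d - D) _ ly.
rewrite subnK // mulrBr mulrCA -exprD subnK // => /(lowB lr).
by rewrite opprB addrA subrK.
Qed.

End Hilbert.

Lemma noetherian_int : noetherian_ring int.
Proof.
move=> V Vs _.
have VM a x : V x -> V (a * x) by apply: (@submoduleZ _ int^o V a x Vs).
have VB x y : V x -> V y -> V (x - y) by apply: (submoduleB Vs).
case: (pselect (exists n, `[< V n.+1%:Z >])) => [exn|nex].
  case: (ex_minnP exn) => n /asboolP Vn nmin; exists [:: n.+1%:Z] => x; split; last first.
    by apply=> // y; rewrite inE => /eqP->.
  move=> Vx U Us Ug; rewrite (divz_eq x n.+1%:Z).
  have -> : (x %% n.+1%:Z)%Z = 0.
    have : V (x %% n.+1%:Z)%Z by rewrite /modz; apply: VB => //; apply: VM.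
    have := ltz_pmod x (isT : 0 < n.+1%:Z).
    have := modz_ge0 x (isT : n.+1%:Z != 0).
    case: (x %% n.+1%:Z)%Z => [[|k]|k] //= _ kn /asboolP /nmin nk.
    by move: kn; rewrite ltz_nat ltnS ltnNge nk.
  rewrite addr0; apply: (@submoduleZ _ int^o U _ n.+1%:Z Us); apply: Ug.
  exact: mem_head.
exists [::] => x; split=> [Vx|]; last by apply.
suff -> : x = 0 by apply: (proj1 (generated_submodule _)).
case: x Vx => [[|n]|n] //= Vn; case: nex; exists n; apply/asboolP => //.
by have := VM (-1) _ Vn; rewrite mulN1r NegzE opprK.
Qed.

(** An image is generated as an algebra by the single element 0. *)
Lemma noetherian_image (R S : comPzRingType) (phi : {rmorphism R -> S}) :
  (forall s, exists r, phi r = s) -> noetherian_ring R -> noetherian_ring S.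
Proof.
move=> surj; apply: (@hilbert_basis _ _ phi 0) => Q Qphi _ _ _ x.
by have [r <-] := surj x.
Qed.

(** R[X_0, ..., X_n] is generated over R[X_1, ..., X_n] by X_0. *)
Lemma noetherian_mvpoly (R : comPzRingType) n :
  noetherian_ring R -> noetherian_ring (mvpoly n R).
Proof.
move=> Rn; elim: n => [|n IH].
  apply: (@hilbert_basis _ _ (mvpolyC 0 R) 0 _ Rn) => Q QC _ QD QM.
  by apply: mvpoly_ind => [|[]||].
have [phi [phiC phiX]] :=
  mvpoly_lift (mvpolyC n.+1 R) (fun i : 'I_n => mvX R (lift ord0 i)).
apply: (@hilbert_basis _ _ phi (mvX R ord0) _ IH) => Q Qphi Qt QD QM.
apply: mvpoly_ind => [r|i||]; [by rewrite -phiC| |exact: QD|exact: QM].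
by case: (unliftP ord0 i) => [j|] ->; [rewrite -phiX; apply: Qphi|exact: Qt].
Qed.

Lemma noetherian_finite_type (R : comPzRingType) :
  finite_type_Z R -> noetherian_ring R.
Proof.
move=> [n [e surj]]; apply: (noetherian_image surj).
exact/noetherian_mvpoly/noetherian_int.
Qed.

(** * Krull's intersection theorem *)

Definition products (R : comPzRingType) (F : seq R) n (p : R) :=
  exists s, [/\ size s = n, {subset s <= F} & p = \prod_(a <- s) a].

Notation ideal_pow F n := (ideal_gen (products F n)).

(** A long product of elements of F contains a high power of one of them. *)
Lemma pigeonhole_seq (T : eqType) (F s : seq T) m :
  {subset s <= F} -> (forall a, a \in F -> count_mem a s <= m)%N ->
  (size s <= m * size F)%N.
Proof.
elim: F s => [|a F IH] s sF sm.
  by case: s sF {sm} => [|b s] // /(_ b (mem_head _ _)).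
have -> : size s = (count_mem a s + size (filter (predC1 a) s))%N.
  by rewrite size_filter count_predC.
rewrite mulnS leq_add ?sm ?mem_head //; apply: IH => b.
  by rewrite mem_filter => /andP[/= ba /sF]; rewrite inE (negbTE ba).
move=> bF; apply: leq_trans (sm b _); last by rewrite inE bF orbT.
by rewrite count_filter; apply: sub_count => c /andP[].
Qed.

Lemma prod_count_mem (R : comPzRingType) (s : seq R) a :
  \prod_(b <- s) b =
  a ^+ count_mem a s * \prod_(b <- filter (predC1 a) s) b.
Proof.
elim: s => [|b s IH]; first by rewrite !big_nil expr0 mulr1.
rewrite big_cons IH /=; case: eqVneq => [->|ba] /=; first by rewrite exprS mulrA.
by rewrite big_cons mulrCA.
Qed.

Lemma ideal_powM (R : comPzRingType) (F : seq R) m n x y :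
  x \in ideal_pow F m -> y \in ideal_pow F n -> x * y \in ideal_pow F (m + n).
Proof.
move=> xm yn; move: x xm; apply: ideal_gen_ind => [|x z xI zI|a _ [s [sm sF ->]]].
- by rewrite mul0r rpred0.
- by rewrite mulrDl rpredD.
move: y yn; apply: ideal_gen_ind => [|x z xI zI|b _ [t [tn tF ->]]].
- by rewrite mulr0 rpred0.
- by rewrite mulrDr rpredD.
rewrite mulrACA; apply: ideal_mull; apply: mem_ideal_gen.
exists (s ++ t); split; first by rewrite size_cat sm tn.
  by move=> c; rewrite mem_cat => /orP[/sF|/tF].
by rewrite big_cat.
Qed.

Lemma ideal_pow_le (R : comPzRingType) (F : seq R) m n x : (m <= n)%N ->
  x \in ideal_pow F n -> x \in ideal_pow F m.
Proof.
move=> mn; move: x; apply: ideal_gen_ind => [|x z xI zI|a _ [s [sn sF ->]]].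
- by rewrite rpred0.
- by rewrite rpredD.
rewrite -(cat_take_drop m s) big_cat [X in a * X]mulrC mulrA.
apply: ideal_mull; apply: mem_ideal_gen.
exists (take m s); split=> [|c /mem_take/sF //|//].
by rewrite size_takel // sn.
Qed.

Lemma ideal_pow1 (R : comPzRingType) (F : seq R) x :
  x \in ideal_gen (fun p => p \in F) <-> x \in ideal_pow F 1.
Proof.
split; move: x; apply: ideal_gen_ind => [|x z xI zI|a x Xx];
  do ?[exact: rpred0 | exact: rpredD].
  apply: ideal_mull; apply: mem_ideal_gen; exists [:: x]; split=> //.
    by move=> c; rewrite inE => /eqP->.
  by rewrite big_seq1.
apply: ideal_mull; apply: mem_ideal_gen.
case: Xx => -[|b [|c s]] [//= _ sF ->]; rewrite big_seq1; apply: sF; exact: mem_head.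
Qed.

Lemma rmorph_ideal_pow (R S : comPzRingType) (f : {rmorphism R -> S})
    (F : seq R) (G : seq S) k n :
  (forall a, a \in F -> f a \in ideal_pow G k) ->
  forall x, x \in ideal_pow F n -> f x \in ideal_pow G (k * n).
Proof.
move=> FG; apply: rmorph_ideal_gen => _ [s [<- sF ->]].
elim: s sF => [|a s IH] sF.
  rewrite muln0 big_nil rmorph1; apply: mem_ideal_gen; exists [::]; split=> //.
  by rewrite big_nil.
rewrite big_cons rmorphM /= mulnS; apply: ideal_powM.
  by apply: FG; apply: sF; apply: mem_head.
by apply: IH => b bs; apply: sF; rewrite inE bs orbT.
Qed.

Section Krull.
Variables (R : comPzRingType) (M : lmodType R) (U W : M -> Prop).
Variables (F : seq R) (x : M).
Hypotheses (Un : noetherian U) (Us : submodule U) (Ws : submodule W).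
Hypothesis WU : forall w, W w -> U w.
Hypothesis Fx : forall a, a \in F -> W (a *: x).
Hypothesis xpow : forall n, exists w y,
  [/\ W w, generated (fun y => exists p z, [/\ products F n p, U z & y = p *: z]) y
    & x = w + y].

(** Krull's intersection theorem in the quotient U / W, for an element x killed by the
ideal I of F: if x lies in I^n U modulo W for all n, then x lies in W.
Otherwise take T maximal among the submodules that contain W but not x. For a in F
the submodules of the z with a^m z in T stabilise at some m. If a^m U were not inside
T, maximality would give x = a^m z + t with t in T; then a x in W makes a^(m+1) z lie
in T, hence also a^m z by the choice of m, and x itself. So each generator of I has a
power that maps U into T, and then so does a power of I; as x is in
W + I^n U, this puts x in T. *)
Lemma krull_intersection : W x.
Proof.
apply: contrapT => nWx.
pose Q T := [/\ submodule T, forall y, T y -> U y, forall w, W w -> T w & ~ T x].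
have [|//|T [Ts TU WT nTx] Tmax] := noetherian_max (Q := Q) (T0 := W) Un.
  by move=> T [].
have killed a : a \in F -> exists m, forall z, U z -> T (a ^+ m *: z).
  move=> aF; pose C m z := U z /\ T (a ^+ m *: z).
  have [|m z []//|m z [Uz Tz]|m mmax] := @noetherian_acc _ _ U C Un.
  - move=> m; split=> [|b y z [Uy Ty] [Uz Tz]].
      by split; [apply: (proj1 Us) | rewrite scaler0; apply: (proj1 Ts)].
    split; first exact: (proj2 Us).
    by rewrite scalerDr scalerA mulrC -scalerA; apply: (proj2 Ts).
  - by split=> //; rewrite exprS -scalerA; apply: submoduleZ.
  exists m; pose T' y := exists z t, [/\ U z, T t & y = a ^+ m *: z + t].
  have T's : submodule T'.
    split=> [|b _ _ [z [t [Uz Tt ->]]] [z' [t' [Uz' Tt' ->]]]].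
      exists 0, 0; split; [exact: (proj1 Us)|exact: (proj1 Ts)|by rewrite scaler0 addr0].
    exists (b *: z + z'), (b *: t + t'); split; [exact: (proj2 Us)|exact: (proj2 Ts)|].
    by rewrite !scalerDr addrACA !scalerA mulrC.
  have TT' y : T y -> T' y.
    by move=> Ty; exists 0, y; split=> //; [exact: (proj1 Us)|rewrite scaler0 add0r].
  have T'U y : T' y -> U y.
    move=> [z [t [Uz Tt ->]]]; apply: (submoduleD Us); last exact: TU.
    exact: submoduleZ.
  case: (pselect (T' x)) => [[z [t [Uz Tt xE]]]|nT'x].
    case: nTx; rewrite xE; apply: (submoduleD Ts) => //.
    suff [] : C m z by [].
    apply: (mmax m.+1); split=> //.
    rewrite exprS -scalerA.
    have -> : a ^+ m *: z = x - t by rewrite xE addrK.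
    rewrite scalerBr; apply: (submoduleB Ts); first exact/WT/Fx.
    exact: submoduleZ.
  move=> z Uz; apply: (Tmax T'); first by split=> // w /WT; apply: TT'.
    exact: TT'.
  by exists z, 0; split=> //; [exact: (proj1 Ts)|rewrite addr0].
have [m mP] : exists m, forall a, a \in F -> forall z, U z -> T (a ^+ m *: z).
  apply: (@seq_bound _ (fun a m => forall z, U z -> T (a ^+ m *: z)) F) => //.
  move=> a m n mn am z Uz.
  by rewrite -(subnK mn) exprD -scalerA; apply: submoduleZ => //; apply: am.
(* One factor more than in the pigeonhole bound: some a occurs more than m times. *)
have [w [y [Ww yg xE]]] := xpow (m * size F).+1.
apply: nTx; rewrite xE; apply: (submoduleD Ts); first exact: WT.
apply: yg => // _ [_ [z [[s [sn sF ->]] Uz ->]]].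
have [a aF am] : exists2 a, a \in F & (m < count_mem a s)%N.
  apply: contrapT => noa.
  have : (size s <= m * size F)%N.
    apply: pigeonhole_seq => // a aF; rewrite leqNgt; apply/negP => am.
    by apply: noa; exists a.
  by rewrite sn ltnn.
rewrite (prod_count_mem s a) mulrC -(subnK (ltnW am)) exprD mulrA -scalerA.
by apply: submoduleZ => //; apply: mP.
Qed.

End Krull.

Section Purity.
Variables (P S : comPzRingType) (E : {rmorphism P -> S}) (F : seq P).
Variables (sigma : {rmorphism P -> P}) (tau : {rmorphism S -> S}).
Hypothesis Pn : noetherian_ring P.
Hypothesis Einj : injective E.
Hypothesis sigma_id : forall p, sigma p - p \in ideal_gen (fun q => q \in F).
Hypothesis sigma_sqr : forall q, q \in F -> sigma q \in ideal_pow F 2.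
Hypothesis tauE : forall p, tau (E p) = E (sigma p).
Hypothesis S_gen : forall y : S, @generated P (restrict_scalars E) (fun a => tau a = a :> S) y.

(** The elements of the extension of I to S, written with coefficients fixed by tau. *)
Let relation y := exists l : seq (S * P),
  (forall x, x \in l -> tau x.1 = x.1 /\ x.2 \in ideal_gen (fun q => q \in F)) /\
  y = \sum_(x <- l) x.1 * E x.2.

Let relation_submod : @submodule P (restrict_scalars E) relation.
Proof.
split=> [|a _ _ [l [lP ->]] [k [kP ->]]].
  by exists [::]; rewrite big_nil.
exists ([seq (x.1, a * x.2) | x <- l] ++ k); split=> [x|].
  rewrite mem_cat => /orP[/mapP[z zl ->]|/kP //] /=.
  by have [-> zI] := lP z zl; split=> //; apply: ideal_mull.
rewrite big_cat big_map; congr (_ + _).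
rewrite restrict_scalarsE mulr_sumr; apply: eq_bigr => x _ /=.
by rewrite rmorphM mulrCA.
Qed.

Let relation_ideal y :
  y \in ideal_gen (fun q => q \in [seq E p | p <- F]) -> relation y.
Proof.
move: y; apply: ideal_gen_ind => [|y z|c _ /mapP[f fF ->]].
- exact: (proj1 relation_submod).
- exact: (submoduleD relation_submod).
have := S_gen c; move/(_ (fun c => relation (c * E f))); apply.
  split=> [|a x y xf yf]; first by rewrite mul0r; apply: (proj1 relation_submod).
  by rewrite mulrDl restrict_scalarsE -mulrA; apply: (proj2 relation_submod).
move=> a ta; exists [:: (a, f)]; rewrite big_seq1; split=> // x.
by rewrite inE => /eqP-> /=; split=> //; apply: mem_ideal_gen.
Qed.

(** The ideal I of F is the contraction of its extension to S, although E is
only assumed injective. From E p = sum_j a_j E(r_j) with r_j in I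
and a_j fixed by tau, iterating tau gives E(sigma^n p) = sum_j a_j E(sigma^n r_j) in
I^(2^n) U, where U is the P-span of 1 and the a_j; and sigma^n p = p modulo I.
Krull's theorem for the class of E p in U / E(I) concludes. *)
Theorem ideal_contraction p :
  E p \in ideal_gen (fun q => q \in [seq E p | p <- F]) ->
  p \in ideal_gen (fun q => q \in F).
Proof.
move=> /relation_ideal [l [lP pE]].
set I := ideal_gen _.
pose U : restrict_scalars E -> Prop :=
  spanned (1 :: [seq x.1 | x <- l] : seq (restrict_scalars E)).
pose W (y : restrict_scalars E) := exists2 i, i \in I & y = E i.
have Us : submodule U by apply: generated_submodule.
have iter_id k q : iter k sigma q - q \in I.
  elim: k => [|k IH]; first by rewrite subrr rpred0.
  by rewrite iterS -(subrK (iter k sigma q) (sigma _)) -addrA rpredD.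
have iter_pow k q : q \in I -> iter k sigma q \in ideal_pow F (2 ^ k).
  move=> qI; elim: k => [|k IH]; first exact/ideal_pow1.
  by rewrite iterS expnS; apply: rmorph_ideal_pow IH.
have iter_tau k : E (iter k sigma p) = \sum_(x <- l) x.1 * E (iter k sigma x.2).
  elim: k => [|k IH] //=.
  rewrite -tauE IH rmorph_sum; apply: eq_big_seq => x xl.
  by rewrite rmorphM tauE; have [-> _] := lP x xl.
suff [i iI /Einj ->] : W (E p) by [].
apply: (@krull_intersection P (restrict_scalars E) U W F).
- exact: noetherian_span.
- exact: Us.
- split=> [|a _ _ [i iI ->] [j jI ->]]; first by exists 0; rewrite ?rpred0 ?rmorph0.
  exists (a * i + j); first by rewrite rpredD // ideal_mull.
  by rewrite rmorphD rmorphM.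
- move=> _ [i _ ->]; rewrite -[E i]mulr1; apply: (@submoduleZ _ (restrict_scalars E) U i 1 Us).
  by apply: mem_generated; apply: mem_head.
- move=> a aF; exists (a * p); last by rewrite rmorphM.
  by rewrite mulrC; apply: ideal_mull; apply: mem_ideal_gen.
move=> n; exists (E (p - iter n sigma p)), (E (iter n sigma p)); split.
- by exists (p - iter n sigma p) => //; rewrite -opprB rpredN.
- rewrite iter_tau; set X := fun y => _.
  have Xs : @submodule P (restrict_scalars E) (generated X) by apply: generated_submodule.
  rewrite big_seq; apply: big_ind; first exact: (proj1 Xs).
    by move=> y z Xy Xz; exact: (@submoduleD P (restrict_scalars E) _ y z Xs Xy Xz).
  move=> x xl; have [_ xI] := lP x xl.
  have := ideal_pow_le (ltnW (ltn_expl n (isT : 1 < 2)%N)) (iter_pow n _ xI).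
  move: (iter n sigma x.2); apply: ideal_gen_ind => [|y z Xy Xz|a q qF].
  - by rewrite rmorph0 mulr0; apply: (proj1 Xs).
  - by rewrite rmorphD mulrDr; apply: (submoduleD Xs).
  apply: mem_generated; exists q, (E a * x.1); split=> //.
    apply: (@submoduleZ _ (restrict_scalars E) U a x.1 Us); apply: mem_generated.
    by rewrite inE map_f ?orbT.
  by rewrite restrict_scalarsE rmorphM mulrC -mulrA mulrCA.
by rewrite rmorphB subrK.
Qed.

End Purity.

(** * Formal smoothness as a section modulo the square of the ideal *)

Lemma rmorphism_inv (R S : comPzRingType) (e : {rmorphism R -> S}) :
  bijective e ->
  exists e' : {rmorphism S -> R}, cancel e e' /\ cancel e' e.
Proof.
case=> d eK dK.
have dB : zmod_morphism d by apply: can2_zmod_morphism eK dK.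
have dM : monoid_morphism d by apply: can2_monoid_morphism eK dK.
pose e' : {rmorphism S -> R} := HB.pack d
  (GRing.isZmodMorphism.Build _ _ _ dB) (GRing.isMonoidMorphism.Build _ _ _ dM).
by exists e'.
Qed.

Notation list_ideal F := (ideal_gen (fun p => p \in F)).

(** With P the polynomial ring and I the ideal of F, these conditions say that sigma
induces an R-algebra section P / I -> P / I^2 of the projection. *)
Definition section_mod_square (R : comPzRingType) n (F : seq (mvpoly n R))
    (sigma : {rmorphism mvpoly n R -> mvpoly n R}) :=
  [/\ forall r, sigma (mvpolyC n R r) = mvpolyC n R r,
      forall p, sigma p - p \in list_ideal F
    & forall q, q \in F -> sigma q \in ideal_pow F 2].

Section Smoothness.
Variables (R : comPzRingType) (n : nat) (F : seq (mvpoly n R)).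

(** Formal smoothness is applied to C = P / I^2, its square-zero ideal J = I / I^2 and
the isomorphism B -> P / I -> C / J; sigma lifts to P the resulting B -> C. *)
Lemma formally_smooth_section (B : comPzRingType) (f : {rmorphism R -> B})
    (e : {rmorphism quo (list_ideal F) -> B}) :
  bijective e -> (forall r, e (quo_pi _ (mvpolyC n R r)) = f r) ->
  formally_smooth f -> exists sigma, section_mod_square F sigma.
Proof.
move=> /rmorphism_inv [e' [eK e'K]] eC fs.
pose C := quo (ideal_pow F 2).
pose piC : {rmorphism mvpoly n R -> C} := quo_pi (ideal_pow F 2).
pose J := ideal_gen (fun c : C => c \in [seq piC p | p <- F]).
have IJ p : p \in list_ideal F -> piC p \in J.
  apply: (rmorph_ideal_gen (f := piC)) => q qF.
  by apply: mem_ideal_gen; apply: map_f.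
have JI c : c \in J -> exists2 p, p \in list_ideal F & piC p = c.
  move: c; apply: ideal_gen_ind => [|x y [p pI <-] [q qI <-]|a x /mapP[q qF ->]].
  - by exists 0; rewrite ?rpred0 ?rmorph0.
  - by exists (p + q); rewrite ?rpredD ?rmorphD.
  - exists (repr a * q); first by apply: ideal_mull; apply: mem_ideal_gen.
    by rewrite rmorphM; congr (_ * _); apply: quo_piK.
have J2 x y : x \in J -> y \in J -> x * y = 0.
  move=> /JI [p pI <-] /JI [q qI <-]; rewrite -rmorphM; apply/quo_pi_eq0.
  by apply: (@ideal_powM _ F 1 1); apply/ideal_pow1.
have [u0 u0E] : exists u0 : {rmorphism quo (list_ideal F) -> quo J},
    forall p, u0 (quo_pi _ p) = quo_pi J (piC p).
  apply: (@quo_lift _ _ _ (quo_pi J \o piC)) => p /IJ.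
  by move/quo_pi_eq0.
have [|v [vf vu]] := fs C (piC \o mvpolyC n R) J J2 (u0 \o e').
  by move=> r; rewrite /= -eC eK u0E.
(* Evaluation at representatives of the images of the variables. *)
have [sigma [sC sX]] := mvpoly_lift (mvpolyC n R)
  (fun i => repr (v (e (quo_pi _ (mvX R i))))).
have sE p : piC (sigma p) = v (e (quo_pi _ p)).
  apply: (mvpoly_ext (e := piC \o sigma) (e' := v \o e \o quo_pi _)) => [r|i] /=.
    by rewrite sC eC vf.
  by rewrite sX; apply: quo_piK.
exists sigma; split=> // [p|q qF].
  have /JI [q qI qE] : piC (sigma p - p) \in J.
    by apply/quo_pi_eq0; rewrite !rmorphB /= sE vu /= eK u0E subrr.
  have : sigma p - p - q \in ideal_pow F 2.
    by apply/quo_pi_eq0; rewrite -[LHS]/(piC _) rmorphB qE subrr.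
  move=> /(ideal_pow_le (isT : 1 <= 2)%N) /ideal_pow1 pq.
  by rewrite -(subrK q (sigma p - p)) rpredD.
apply/quo_pi_eq0; rewrite -[LHS]/(piC _) sE (_ : quo_pi _ q = 0) ?rmorph0 //.
by apply/quo_pi_eq0; apply: mem_ideal_gen.
Qed.

(** Any lift v : P -> C of u on the variables maps I into J and so kills I^2. It need
not kill I, but its composite with sigma does, and both agree modulo J. *)
Lemma section_formally_smooth sigma : section_mod_square F sigma ->
  formally_smooth (quo_pi (list_ideal F) \o mvpolyC n R).
Proof.
move=> [sC sI sF] C i J J2 u uE.
have [v [vC vX]] := mvpoly_lift i (fun j => repr (u (quo_pi _ (mvX R j)))).
have vE p : quo_pi J (v p) = u (quo_pi _ p).
  apply: (mvpoly_ext (e := quo_pi J \o v) (e' := u \o quo_pi _)) => [r|j] /=.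
    by rewrite vC -uE.
  by rewrite vX quo_piK.
have vJ p : p \in list_ideal F -> v p \in J.
  by move=> pI; apply/quo_pi_eq0; rewrite vE (proj2 (quo_pi_eq0 _ p) pI) rmorph0.
have v2 p : p \in ideal_pow F 2 -> v p = 0.
  apply: rmorph_ideal_gen0 => _ [[|a [|b [|c s]]] [//= _ sF' ->]].
  rewrite big_cons big_seq1 rmorphM /= J2 //; apply/vJ/mem_ideal_gen/sF'.
    exact: mem_head.
  by rewrite !inE eqxx orbT.
have [|w wE] := @quo_lift _ (list_ideal F) C (v \o sigma).
  by apply: rmorph_ideal_gen0 => p pF; apply/v2/sF.
exists w; split=> [r|s]; first by rewrite /= wE /= sC vC.
rewrite -(quo_piK s) wE /= vE; congr (u _); apply/quo_piP; exact: sI.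
Qed.

End Smoothness.

Section Flatness.
Variables (R A B : comPzRingType) (g : {rmorphism R -> B}) (h : {rmorphism R -> A}).

(** The tensor product maps to A[X_1, ..., X_n] / (F), so a polynomial p representing
an element killed by [tens_inr] lies in the ideal generated by F over A. Contraction
applies with sigma extended to an endomorphism tau that fixes A. *)
Theorem smooth_tens_inr_injective :
  noetherian_ring R -> smooth g -> injective h -> injective (tens_inr h g).
Proof.
move=> Rn [[n [F [e [ebij eC]]]] gs] hinj.
have [sigma [sC sI sF]] := formally_smooth_section ebij eC gs.
have [e' [eK e'K]] := rmorphism_inv ebij.
have [E [EC EX EU Ecoef]] := mvpoly_map n h.
have Einj : injective E.
  move=> p q Epq; apply/malgP => k; apply: hinj.
  by rewrite -!Ecoef Epq.
have [tau [tC tX]] := mvpoly_lift (mvpolyC n A) (fun i => E (sigma (mvX R i))).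
have tE p : tau (E p) = E (sigma p).
  apply: (mvpoly_ext (e := tau \o E) (e' := E \o sigma)) => [r|i] /=.
    by rewrite EC tC sC EC.
  by rewrite EX tX.
pose IA := list_ideal [seq E p | p <- F].
have [w wE] : exists w : {rmorphism quo (list_ideal F) -> quo IA},
    forall p, w (quo_pi _ p) = quo_pi _ (E p).
  apply: (@quo_lift _ _ _ (quo_pi IA \o E)).
  apply: rmorph_ideal_gen0 => p pF; apply/quo_pi_eq0; apply: mem_ideal_gen.
  exact: map_f.
have [|t tT] := @tensor_lift R A B _ h g (quo_pi IA \o mvpolyC n A) (w \o e').
  by move=> r; rewrite /= -eC eK wE EC.
apply: raddf_inj => b b0; rewrite -(e'K b) -(quo_piK (e' b)).
set p := repr _; rewrite (_ : quo_pi _ p = 0) ?rmorph0 //; apply/quo_pi_eq0.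
apply: (ideal_contraction (E := E) (sigma := sigma) (tau := tau)) => //.
- exact: noetherian_mvpoly.
- move=> y; have Gs := generated_submodule (M := restrict_scalars E)
    (fun a => tau a = a :> mvpoly n A).
  rewrite (monr_sumU y); apply: big_ind; first exact: (proj1 Gs).
    by move=> x z Gx Gz; exact: (@submoduleD _ (restrict_scalars E) _ x z Gs Gx Gz).
  move=> k _; have -> : << y@_k *g k >> = E (monrU _ 1 k) * mvpolyC n A y@_k.
    by rewrite EU rmorph1 [RHS]monrUM mul1r Monoid.mulm1.
  apply: (@submoduleZ _ (restrict_scalars E) _ (monrU _ 1 k) _ Gs); apply: mem_generated.
  exact: tC.
apply/quo_pi_eq0; rewrite -wE quo_piK.
have := congr1 t b0; rewrite tT rmorph0 rmorph1 mul1r; apply.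
Qed.

End Flatness.

(** * Descent to a base of finite type *)

Lemma finite_type_image (R S : comPzRingType) (phi : {rmorphism R -> S}) :
  (forall s, exists r, phi r = s) -> finite_type_Z R -> finite_type_Z S.
Proof.
move=> surj [n [e esurj]]; exists n, (phi \o e) => s.
by have [r <-] := surj s; have [p <-] := esurj r; exists p.
Qed.

Lemma finite_type_mvpoly (R : comPzRingType) n :
  finite_type_Z R -> finite_type_Z (mvpoly n R).
Proof.
move=> [m [e esurj]].
have [phi [phiC phiX]] := mvpoly_lift (intr : {rmorphism int -> mvpoly n R})
  (fun i : 'I_(m + n) => match split i with
     | inl j => mvpolyC n R (e (mvX _ j)) | inr k => mvX R k end).
have phiD p q : (exists x, phi x = p) -> (exists x, phi x = q) -> exists x, phi x = p + q.
  by move=> [x <-] [y <-]; exists (x + y); rewrite rmorphD.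
have phiM p q : (exists x, phi x = p) -> (exists x, phi x = q) -> exists x, phi x = p * q.
  by move=> [x <-] [y <-]; exists (x * y); rewrite rmorphM.
exists (m + n)%N, phi; apply: mvpoly_ind => [r|k||]; [| |exact: phiD|exact: phiM].
  have [q <-] := esurj r; move: q; apply: mvpoly_ind => [z|j|p q|p q].
  - exists (mvpolyC _ _ z); rewrite phiC -[z in RHS]intz.
    by rewrite (rmorph_int (mvpolyC m int)) !rmorph_int.
  - by exists (mvX _ (lshift n j)); rewrite phiX (unsplitK (inl j)).
  - by rewrite !rmorphD; apply: phiD.
  - by rewrite !rmorphM; apply: phiM.
by exists (mvX _ (rshift m k)); rewrite phiX (unsplitK (inr k)).
Qed.

(** The subring generated by L, built as Z[X_1, ..., X_n] modulo the kernel of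
evaluation at L. *)
Lemma finite_type_subring (A : comPzRingType) (L : seq A) :
  exists (A0 : comPzRingType) (h : {rmorphism A0 -> A}),
    [/\ finite_type_Z A0, injective h & forall a, a \in L -> exists a0, h a0 = a].
Proof.
have [phi [phiC phiX]] := mvpoly_lift (intr : {rmorphism int -> A}) (tnth (in_tuple L)).
have [|h hE] := @quo_lift _ (ideal_gen (fun p => phi p = 0)) _ phi.
  exact: rmorph_ideal_gen0.
exists (quo (ideal_gen (fun p => phi p = 0))), h; split.
- by exists (size L), (quo_pi _) => q; exists (repr q); apply: quo_piK.
- apply: raddf_inj => q hq; rewrite -(quo_piK q); apply/quo_pi_eq0.
  by apply: mem_ideal_gen; rewrite -hE quo_piK.
- move=> a /(tnthP (in_tuple L)) [i ->].
  by exists (quo_pi _ (mvX _ i)); rewrite hE phiX.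
Qed.

(** Any finite list of polynomials is defined over the subring generated by their
coefficients. *)
Lemma polynomials_over_finite_type (A : comPzRingType) n (L : seq (mvpoly n A)) :
  exists (A0 : comPzRingType) (h : {rmorphism A0 -> A})
         (E : {rmorphism mvpoly n A0 -> mvpoly n A}),
    [/\ finite_type_Z A0, injective h,
        (forall r, E (mvpolyC n A0 r) = mvpolyC n A (h r)) /\
        (forall i, E (mvX A0 i) = mvX A i),
        injective E
      & forall p, p \in L -> exists p0, E p0 = p].
Proof.
have [A0 [h [A0f hinj hL]]] :=
  finite_type_subring (flatten [seq [seq p@_k | k <- msupp p] | p <- L]).
have [E [EC EX EU Ecoef]] := mvpoly_map n h.
exists A0, h, E; split=> // [p q Epq|p pL].
  by apply/malgP => k; apply: hinj; rewrite -!Ecoef Epq.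
rewrite (monr_sumU p) big_seq.
apply: (big_ind (fun p => exists p0, E p0 = p)) => [|x y [x0 <-] [y0 <-]|k kp].
- by exists 0; rewrite rmorph0.
- by exists (x0 + y0); rewrite rmorphD.
have [|a ha] := hL p@_k; last by exists (monrU _ a k); rewrite EU ha.
by apply/flattenP; exists [seq p@_k | k <- msupp p]; apply/mapP; [exists p|exists k].
Qed.

Lemma preimage_seq (T U : eqType) (E : T -> U) (Q : T -> Prop) (s : seq U) :
  (forall a, a \in s -> exists2 a0, Q a0 & E a0 = a) ->
  exists2 s0, (forall a0, a0 \in s0 -> Q a0) & map E s0 = s.
Proof.
elim: s => [|a s IH] sQ; first by exists [::].
have [a0 Qa0 <-] := sQ a (mem_head a s).
have [|s0 Qs0 <-] := IH; first by move=> b bs; apply: sQ; rewrite inE bs orbT.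
by exists (a0 :: s0) => // b; rewrite inE => /orP[/eqP->|/Qs0].
Qed.

(** L collects the coefficients of one expression of x as a combination of X: over
any base that contains these coefficients, and the generators, x is again in
the ideal. *)
Definition descends (R : comPzRingType) (X : R -> Prop) (L : seq R) (x : R) :=
  forall (R0 : comPzRingType) (E : {rmorphism R0 -> R}) (X0 : R0 -> Prop),
    (forall c, c \in L -> exists c0, E c0 = c) ->
    (forall y, X y -> exists2 y0, X0 y0 & E y0 = y) ->
  exists2 x0, x0 \in ideal_gen X0 & E x0 = x.

Lemma ideal_gen_descends (R : comPzRingType) (X : R -> Prop) x :
  x \in ideal_gen X -> exists L, descends X L x.
Proof.
move=> /ideal_genP [k [c [y [Xy ->]]]]; exists (codom c) => R0 E X0 EL EX.
apply: (big_ind (fun x => exists2 x0, x0 \in ideal_gen X0 & E x0 = x)).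
- by exists 0; rewrite ?rpred0 ?rmorph0.
- by move=> _ _ [p pI <-] [q qI <-]; exists (p + q); rewrite ?rpredD ?rmorphD.
move=> i _; have [c0 <-] := EL (c i) (codom_f c i); have [y0 Xy0 <-] := EX _ (Xy i).
by exists (c0 * y0); rewrite ?rmorphM // ideal_mull // mem_ideal_gen.
Qed.

Lemma ideal_gen_descends_seq (R : comPzRingType) (X : R -> Prop) (s : seq R) :
  (forall x, x \in s -> x \in ideal_gen X) ->
  exists L, forall x, x \in s -> descends X L x.
Proof.
elim: s => [|x s IH] sX; first by exists [::].
have [|L LP] := IH; first by move=> y ys; apply: sX; rewrite inE ys orbT.
have [K KP] := ideal_gen_descends (sX x (mem_head x s)).
exists (K ++ L) => y; rewrite inE => /orP[/eqP->|/LP yL] R0 E X0 EL.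
  by apply: KP => c cK; apply: EL; rewrite mem_cat cK.
by apply: yL => c cL; apply: EL; rewrite mem_cat cL orbT.
Qed.

Section BaseChange.
Variables (A B A0 : comPzRingType) (f : {rmorphism A -> B}) (h : {rmorphism A0 -> A}).
Variables (n : nat) (F0 : seq (mvpoly n A0)).
Variables (E : {rmorphism mvpoly n A0 -> mvpoly n A}).
Hypothesis EC : forall r, E (mvpolyC n A0 r) = mvpolyC n A (h r).
Hypothesis EX : forall i, E (mvX A0 i) = mvX A i.
Variable e : {rmorphism quo (list_ideal [seq E p | p <- F0]) -> B}.
Hypothesis ebij : bijective e.
Hypothesis eC : forall r, e (quo_pi _ (mvpolyC n A r)) = f r.
Let B0 := quo (list_ideal F0).
Let g : {rmorphism A0 -> B0} := quo_pi (list_ideal F0) \o mvpolyC n A0.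

(** The inverse sends the class of a polynomial over A to its value at the elements
1 (x) X_i of the tensor product. *)
Lemma presentation_base_change :
  exists2 t : {rmorphism tensor h g -> B},
    bijective t & forall a, t (tens_inl h g a) = f a.
Proof.
have [e' [eK e'K]] := rmorphism_inv ebij.
have [w wE] : exists w : {rmorphism B0 -> B}, forall p, w (quo_pi _ p) = e (quo_pi _ (E p)).
  apply: (@quo_lift _ _ _ (e \o quo_pi _ \o E)); apply: rmorph_ideal_gen0 => p pF /=.
  rewrite (_ : quo_pi _ (E p) = 0) ?rmorph0 //; apply/quo_pi_eq0/mem_ideal_gen.
  exact: map_f.
have [|t tT] := @tensor_lift A0 A B0 B h g f w.
  by move=> r; rewrite wE EC eC.
have tl a : t (tens_inl h g a) = f a by rewrite tT rmorph1 mulr1.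
have tr b : t (tens_inr h g b) = w b by rewrite tT rmorph1 mul1r.
have [d0 [d0C d0X]] := mvpoly_lift (tens_inl h g)
  (fun i => tens_inr h g (quo_pi _ (mvX A0 i))).
have d0E p : d0 (E p) = tens_inr h g (quo_pi _ p).
  apply: (mvpoly_ext (e := d0 \o E) (e' := tens_inr h g \o quo_pi _)) => [r|i] /=.
    by rewrite EC d0C; have := tensZ h g r 1 1; rewrite !mulr1.
  by rewrite EX d0X.
have [d1 d1E] : exists d1 : {rmorphism quo (list_ideal [seq E p | p <- F0]) -> tensor h g},
    forall p, d1 (quo_pi _ p) = d0 p.
  apply: quo_lift; apply: rmorph_ideal_gen0 => _ /mapP[p pF ->].
  rewrite d0E (_ : quo_pi _ p = 0) ?rmorph0 //; apply/quo_pi_eq0; exact: mem_ideal_gen.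
exists t => //; exists (d1 \o e') => [q|b].
  apply: (tensor_ext (e := d1 \o e' \o t) (e' := idfun)) => [a|b] /=.
    by rewrite tl -eC eK d1E d0C.
  by rewrite tr -(quo_piK b) wE eK d1E d0E.
rewrite /= -{2}(e'K b) -(quo_piK (e' b)); move: (repr _) => p.
apply: (mvpoly_ext (e := t \o d1 \o quo_pi _) (e' := e \o quo_pi _)) => [r|i] /=.
  by rewrite d1E d0C tl eC.
by rewrite d1E d0X tr wE EX.
Qed.

End BaseChange.

(** A0 is generated by the coefficients of F, of the sigma X_i, and of the expressions
witnessing the two membership conditions on sigma. Since polynomials over A0 embed
in those over A, these witnesses still prove the conditions over A0. *)
Theorem smooth_descent_exists (A B : comPzRingType) (f : {rmorphism A -> B}) :
  smooth f ->
  exists (A0 B0 : comPzRingType) (g : {rmorphism A0 -> B0})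
         (h : {rmorphism A0 -> A}) (e : {rmorphism tensor h g -> B}),
    smooth_descent f e /\ injective h.
Proof.
move=> [[n [F [e [ebij eC]]]] fs].
have [sigma [sC sI sF]] := formally_smooth_section ebij eC fs.
have [L1 L1P] : exists L, forall x, x \in [seq sigma (mvX A i) - mvX A i | i : 'I_n] ->
    descends (fun p => p \in F) L x.
  by apply: ideal_gen_descends_seq => _ /mapP[i _ ->]; apply: sI.
have [L2 L2P] : exists L, forall x, x \in [seq sigma q | q <- F] ->
    descends (products F 2) L x.
  by apply: ideal_gen_descends_seq => _ /mapP[q qF ->]; apply: sF.
pose L := F ++ [seq sigma (mvX A i) | i : 'I_n] ++ L1 ++ L2.
have [A0 [h [E [A0f hinj [EC EX] Einj EL]]]] := polynomials_over_finite_type L.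
have [F0 _ F0E] : exists2 F0 : seq (mvpoly n A0), (forall q, q \in F0 -> True) & map E F0 = F.
  apply: (@preimage_seq _ _ E (fun=> True)) => q qF.
  by have [|q0 <-] := EL q; [rewrite mem_cat qF | exists q0].
have /choice [v vE] (i : 'I_n) : exists v, E v = sigma (mvX A i).
  apply: EL; rewrite !mem_cat orbCA; apply/orP; left.
  exact: (codom_f (fun i => sigma (mvX A i))).
(* sigma0 restricts sigma to the polynomials over A0. *)
have [sigma0 [s0C s0X]] := mvpoly_lift (mvpolyC n A0) v.
have Es p : E (sigma0 p) = sigma (E p).
  apply: (mvpoly_ext (e := E \o sigma0) (e' := sigma \o E)) => [r|i] /=.
    by rewrite s0C EC sC.
  by rewrite s0X EX vE.
have EF q : q \in F -> exists2 q0, q0 \in F0 & E q0 = q.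
  by rewrite -F0E => /mapP[q0 q0F ->]; exists q0.
have s0 : section_mod_square F0 sigma0.
  split=> // [p|q qF].
    apply/quo_piP; apply: (mvpoly_ext (e := quo_pi _ \o sigma0) (e' := quo_pi _)) => [r|i] /=.
      by rewrite s0C.
    apply/quo_piP.
    have [||//|x xI xE] := L1P (sigma (mvX A i) - mvX A i) _ _ E (fun q => q \in F0).
    - exact: (codom_f (fun i => sigma (mvX A i) - mvX A i)).
    - by move=> c cL; apply: EL; rewrite !mem_cat cL ?orbT.
    suff -> : sigma0 (mvX A0 i) - mvX A0 i = x by [].
    by apply: Einj; rewrite xE rmorphB /= Es EX.
  have [|||x xI xE] := L2P (sigma (E q)) _ _ E (products F0 2).
  - by apply: map_f; rewrite -F0E map_f.
  - by move=> c cL; apply: EL; rewrite !mem_cat cL ?orbT.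
  - move=> _ [s [s2 sF2 ->]].
    have [|t tF tE] := @preimage_seq _ _ E (fun q => q \in F0) s.
      by move=> a /sF2 /EF.
    exists (\prod_(a <- t) a); last by rewrite rmorph_prod -tE big_map.
    by exists t; split=> //; rewrite -s2 -tE size_map.
  suff -> : sigma0 q = x by [].
  by apply: Einj; rewrite xE Es.
rewrite -F0E in e ebij eC.
have [t tbij tE] := presentation_base_change EC EX ebij eC.
exists A0, (quo (list_ideal F0)), (quo_pi (list_ideal F0) \o mvpolyC n A0), h, t.
split=> //; split=> //.
- apply: (finite_type_image (phi := quo_pi (list_ideal F0))).
    by move=> q; exists (repr q); apply: quo_piK.
  exact: finite_type_mvpoly.
- split; last exact: section_formally_smooth s0.
  by exists n, F0, idfun; split=> //; exists idfun.
Qed.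

Theorem proposition1 (A B : comPzRingType) (f : {rmorphism A -> B}) :
  smooth f ->
  [/\ exists (A0 B0 : comPzRingType) (g : {rmorphism A0 -> B0})
             (h : {rmorphism A0 -> A}) (e : {rmorphism tensor h g -> B}),
        smooth_descent f e,
      exists (A0 B0 : comPzRingType) (g : {rmorphism A0 -> B0})
             (h : {rmorphism A0 -> A}) (e : {rmorphism tensor h g -> B}),
        smooth_descent f e /\ injective h
    & forall (A0 B0 : comPzRingType) (g : {rmorphism A0 -> B0})
             (h : {rmorphism A0 -> A}) (e : {rmorphism tensor h g -> B}),
        smooth_descent f e -> injective h ->
        injective (fun b : B0 => e (tens_inr h g b))].
Proof.
move=> fs; have [A0 [B0 [g [h [e [desc hinj]]]]]] := smooth_descent_exists fs.
split; [by exists A0, B0, g, h, e | by exists A0, B0, g, h, e |].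
move=> {A0 B0 g h e desc hinj} A0 B0 g h e [A0f _ gs ebij _] hinj x y.
move=> /(bij_inj ebij); apply: smooth_tens_inr_injective => //.
exact: noetherian_finite_type.
Qed.
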